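(* For every nonnegative integer $n$, $$\overline{pp}(8n+7)\equiv 0 \pmod{64},$$ $$\overline{pp}(20n+11)\equiv 0 \pmod 5,$$ $$\overline{pp}(20n+15)\equiv 0 \pmod 5,$$ $$\overline{pp}(20n+19)\equiv 0 \pmod 5.$$
   Context: For $|q|<1$, $(a;q)_\infty=\prod_{k=1}^\infty(1-aq^{k-1})$. An overpartition of $n$ is a partition of $n$ in which the first occurrence of each number may be overlined; there is exactly one overpartition of $0$ (the empty one). An overpartition pair of $n$ is an ordered pair $(\lambda,\mu)$ of overpartitions such that the sum of all parts of $\lambda$ and $\mu$ is $n$ (either may be the overpartition of $0$). $\overline{pp}(n)$ denotes the number of overpartition pairs of $n$; its generating function is $\sum_{n\ge 0}\overline{pp}(n)q^n=(-q;q)_\infty^2/(q;q)_\infty^2$. *)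

(* Defs.v *)
From mathcomp Require Import all_boot.

Set Implicit Arguments.
Unset Strict Implicit.
Unset Printing Implicit Defensive.

(* A part is a pair (size, overlined?). In the pairwise condition x comes before
   y: the sizes are nonincreasing, and an overlined part differs in size from
   every earlier part, i.e. it is the first occurrence of its size. *)
Definition overpartition (s : seq (nat * bool)) : bool :=
  all (fun x => 0 < x.1) s &&
  pairwise (fun x y => (y.1 <= x.1) && (y.2 ==> (y.1 != x.1))) s.

Definition weight (s : seq (nat * bool)) : nat := \sum_(x <- s) x.1.

Definition overpartition_pair (n : nat)
    (p : seq (nat * bool) * seq (nat * bool)) : bool :=
  [&& overpartition p.1, overpartition p.2 & weight p.1 + weight p.2 == n].

(* All parts and both lengths are at most n in an overpartition pair of n, so
   the pairs can be counted in a finite type; see pp_bar_count. *)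
Definition bounded_parts (n : nat) : finType := n.-bseq ('I_n.+1 * bool).

Definition nat_parts n (s : bounded_parts n) : seq (nat * bool) :=
  [seq (nat_of_ord x.1, x.2) | x <- (s : n.-bseq ('I_n.+1 * bool))].

Definition pp_bar (n : nat) : nat :=
  #|[set p : bounded_parts n * bounded_parts n |
      overpartition_pair n (nat_parts p.1, nat_parts p.2)]|.

Lemma nat_parts_inj n : injective (@nat_parts n).
Proof.
move=> s t; rewrite /nat_parts => /inj_map st; apply/val_inj/st.
by move=> [i b] [j c] [/= /val_inj-> ->].
Qed.

Lemma nat_parts_surj n s :
  overpartition s -> weight s <= n -> exists t : bounded_parts n, nat_parts t = s.
Proof.
case/andP=> /allP pos _ le_n.
have size_s : size s <= n.
  apply: leq_trans le_n; rewrite /weight -sum1_size big_seq [leqRHS]big_seq.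
  exact: leq_sum.
have le_part x : x \in s -> x.1 <= n.
  move=> xs; apply: leq_trans le_n.
  by rewrite /weight (big_rem x) //= leq_addr.
have size_t : size [seq (inord x.1 : 'I_n.+1, x.2) | x <- s] <= n by rewrite size_map.
exists (Bseq size_t); rewrite /nat_parts /= -map_comp -[RHS]map_id.
apply/eq_in_map => -[k b] ks /=.
by rewrite inordK // ltnS (le_part _ ks).
Qed.

Lemma pp_bar_count n :
  exists s : seq (seq (nat * bool) * seq (nat * bool)),
    [/\ uniq s, forall p, (p \in s) = overpartition_pair n p & size s = pp_bar n].
Proof.
pose f (p : bounded_parts n * bounded_parts n) := (nat_parts p.1, nat_parts p.2).
pose A := [set p | overpartition_pair n (f p)].
exists [seq f p | p <- enum A]; split.
- rewrite map_inj_uniq ?enum_uniq // => -[a b] [c d] [].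
  by move=> /nat_parts_inj-> /nat_parts_inj->.
- move=> [a b]; apply/mapP/idP => [[p] | ab].
    by rewrite mem_enum inE => ? ->.
  case/and3P: (ab) => /= oa ob /eqP w.
  have [|c ca] := nat_parts_surj (n := n) oa; first by rewrite -w leq_addr.
  have [|d db] := nat_parts_surj (n := n) ob; first by rewrite -w leq_addl.
  by exists (c, d); rewrite ?mem_enum ?inE /f /= ca db.
- by rewrite size_map -cardE.
Qed.

(* Main.v *)
Require Import Defs.
From HB Require Import structures.
From mathcomp Require Import all_boot all_algebra.
From mathcomp Require Import boolp ring zify.

Set Implicit Arguments.
Unset Strict Implicit.
Unset Printing Implicit Defensive.

Import GRing.Theory.
Local Open Scope ring_scope.

(** Write P(q) for the generating function of overpartition pairs, and
    phi(q) = sum of q^(n^2) over all integers n,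
    psi(q) = sum of q^(n(n+1)/2) over n >= 0.
    Splitting off the largest part gives the product for overpartitions, and
    Gauss's product for phi(-q) turns it into P(q) phi(-q)^2 = 1 ([pp_gf_phi]).

    The numerator of the fraction 1 / phi(-q)^2 is opened up by the identities
      phi(q) phi(-q) = phi(-q^2)^2,
      phi(q)^2 = phi(q^2)^2 + 4 q psi(q^4)^2,
      phi(q) psi(q^2) = psi(q)^2,
    which follow from the parity splitting phi(q) = phi(q^4) + 2 q psi(q^8) and
    the product formulas.  Together they give ([four_dissection])
      P(q) phi(-q^4)^8 = phi(q)^2 phi(q^2)^4
                       = (exponents 0, 1, 2 mod 4) + 32 q^3 psi(q^4)^6.
    Multiplying or dividing by a series in q^k with constant term 1 does not
    affect divisibility of the coefficients along residue classes modulo k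
    ([vanish_dil], [vanish_cancel]), so only the last term matters for exponents 3 mod 4.

    Modulo 64: psi(q)^2 = psi(q^2) and phi(q) = 1 modulo 2, hence after
    multiplication by phi(q^4)^8 the last term is 32 q^3 times a series in q^8,
    up to multiples of 64, and it misses the exponents 7 mod 8.

    Modulo 5: multiply by phi(-q^4)^2 instead.  By psi(q) phi(-q)^2 = (q;q)^3
    the last term becomes 32 q^3 psi(q^4)^5 (q^4;q^4)^3, where the fifth powers
    psi(q^4)^5 and phi(-q^4)^10 = (phi(-q^4)^5)^2 are congruent to series in
    q^20.  By Jacobi's identity (q;q)^3 is the sum of (-1)^k (2k+1) q^(k(k+1)/2);
    an exponent k(k+1)/2 is 0, 1 or 3 modulo 5, and 3 only if 5 divides 2k+1.  So
    modulo 5 no exponent 2, 3, 4 mod 5 survives, i.e. none of 11, 15, 19 mod 20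
    after q -> q^4 and the shift by q^3.

    The three product formulas, for phi(-q), psi(q) and (q;q)^3, all come from
    one finite form of Jacobi's triple product ([finite_triple_product]), in
    which the Gaussian binomials tend to 1 / (q;q) q-adically ([qbin_E]). *)

(** * The ring of power series with integer coefficients *)

Definition fps := nat -> int.
HB.instance Definition _ := gen_eqMixin fps.
HB.instance Definition _ := gen_choiceMixin fps.

Implicit Types (f g h : fps) (p : {poly int}) (i j k m n N : nat).

Definition trunc N f : {poly int} := \poly_(i < N) f i.
Definition ser p : fps := fun n => p`_n.

Definition fps_zero : fps := fun=> 0.
Definition fps_opp f : fps := fun n => - f n.
Definition fps_add f g : fps := fun n => f n + g n.
Definition fps_one : fps := fun n => (n == 0%N)%:R.
Definition fps_mul f g : fps := fun n => \sum_(i < n.+1) f i * g (n - i)%N.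

Fact fps_addA : associative fps_add.
Proof. by move=> f g h; apply/funext => n; apply: addrA. Qed.
Fact fps_addC : commutative fps_add.
Proof. by move=> f g; apply/funext => n; apply: addrC. Qed.
Fact fps_add0 : left_id fps_zero fps_add.
Proof. by move=> f; apply/funext => n; apply: add0r. Qed.
Fact fps_addN : left_inverse fps_zero fps_opp fps_add.
Proof. by move=> f; apply/funext => n; apply: addNr. Qed.

HB.instance Definition _ :=
  GRing.isZmodule.Build fps fps_addA fps_addC fps_add0 fps_addN.

Definition agree N f g := forall i, (i < N)%N -> f i = g i.

Lemma agree_trunc N f : agree N (ser (trunc N f)) f.
Proof. by move=> i iN; rewrite /ser coef_poly iN. Qed.

Lemma fps_mul_agree N f f' g g' : agree N f f' -> agree N g g' ->
  agree N (fps_mul f g) (fps_mul f' g').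
Proof.
move=> ff gg n nN; apply: eq_bigr => i _.
by rewrite ff ?gg //; have := ltn_ord i; lia.
Qed.

Lemma fps_mul_ser p p' : fps_mul (ser p) (ser p') = ser (p * p').
Proof. by apply/funext => n; rewrite /ser coefM. Qed.

(** Reduces statements about products of series to polynomials, whose ring
    axioms are known; the ring axioms for [fps] are transported this way. *)
Lemma fps_mul_trunc N f g :
  agree N (fps_mul f g) (ser (trunc N f * trunc N g)).
Proof.
rewrite -fps_mul_ser => n nN.
by apply: (fps_mul_agree _ _ nN) => i iN; rewrite agree_trunc.
Qed.

Fact fps_mulA : associative fps_mul.
Proof.
move=> f g h; apply/funext => n; pose N := n.+1.
have tr f' : agree N f' (ser (trunc N f')) by move=> i iN; rewrite agree_trunc.
rewrite (fps_mul_agree (tr f) (@fps_mul_trunc N g h)) //.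
rewrite (fps_mul_agree (@fps_mul_trunc N f g) (tr h)) //.
by rewrite !fps_mul_ser mulrA.
Qed.

Fact fps_mulC : commutative fps_mul.
Proof. by move=> f g; apply/funext => n; rewrite !(@fps_mul_trunc n.+1) // mulrC. Qed.

Fact fps_mul1 : left_id fps_one fps_mul.
Proof.
move=> f; apply/funext => n; rewrite /fps_mul big_ord_recl subn0 mul1r.
by rewrite big1 ?addr0 // => i _; rewrite mul0r.
Qed.

Fact fps_mulDl : left_distributive fps_mul fps_add.
Proof.
move=> f g h; apply/funext => n; rewrite /fps_add -big_split.
by apply: eq_bigr => i _; rewrite mulrDl.
Qed.

Fact fps_one_neq0 : fps_one != 0.
Proof. by apply/eqP => /(congr1 (@^~ 0%N)). Qed.

HB.instance Definition _ :=
  GRing.Zmodule_isComNzRing.Build fps fps_mulA fps_mulC fps_mul1 fps_mulDl fps_one_neq0.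

Lemma fpsP f g : (forall N, agree N f g) -> f = g.
Proof. by move=> fg; apply/funext => n; apply: (fg n.+1). Qed.

Lemma fpsD f g n : (f + g) n = f n + g n. Proof. by []. Qed.
Lemma fpsN f n : (- f) n = - f n. Proof. by []. Qed.
Lemma fps1 n : (1 : fps) n = (n == 0%N)%:R. Proof. by []. Qed.
Lemma fpsM f g n : (f * g) n = \sum_(i < n.+1) f i * g (n - i)%N.
Proof. by []. Qed.
Lemma fpsMn f m n : (f *+ m) n = f n *+ m.
Proof. by elim: m => // m IH; rewrite !mulrS fpsD IH. Qed.
Lemma fps_natM m f n : (m%:R * f) n = m%:R * f n.
Proof. by rewrite mulr_natl fpsMn mulr_natl. Qed.
Lemma fps_sum I (r : seq I) (P : pred I) (F : I -> fps) n :
  (\sum_(i <- r | P i) F i) n = \sum_(i <- r | P i) F i n.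
Proof. by elim/big_rec2: _ => // i x y _ <-. Qed.

Lemma agreeM N f f' g g' : agree N f f' -> agree N g g' ->
  agree N (f * g) (f' * g').
Proof. exact: fps_mul_agree. Qed.

Lemma agreeX N k f g : agree N f g -> agree N (f ^+ k) (g ^+ k).
Proof. by move=> fg; elim: k => // k IH; rewrite !exprS; apply: agreeM. Qed.

Lemma natfps_inj m : injective (fun f : fps => m.+1%:R * f).
Proof.
move=> f g fg; apply/funext => n; have := congr1 (@^~ n) fg.
by rewrite /= !fps_natM => /mulfI; apply; rewrite Num.Theory.pnatr_eq0.
Qed.

Fact ser_is_zmod_morphism : zmod_morphism ser.
Proof. by move=> p p'; apply/funext => n; rewrite /ser coefB. Qed.
Fact ser_is_monoid_morphism : monoid_morphism ser.
Proof.
by split=> [|p p']; [apply/funext => n; rewrite /ser coef1 | rewrite -fps_mul_ser].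
Qed.
HB.instance Definition _ := GRing.isZmodMorphism.Build _ _ ser ser_is_zmod_morphism.
HB.instance Definition _ := GRing.isMonoidMorphism.Build _ _ ser ser_is_monoid_morphism.

Definition q : fps := ser 'X.

Lemma qnE k n : (q ^+ k) n = (n == k)%:R.
Proof. by rewrite /q -rmorphXn /= /ser coefXn. Qed.

Lemma qnM k f n : (q ^+ k * f) n = if (n < k)%N then 0 else f (n - k)%N.
Proof.
have -> : (q ^+ k * f) n = ser (trunc n.+1 (q ^+ k) * trunc n.+1 f) n.
  exact: fps_mul_trunc.
have -> : trunc n.+1 (q ^+ k) = if (k <= n)%N then 'X^k else 0.
  apply/polyP => i; rewrite coef_poly qnE ltnS; case: (leqP k n) => kn.
    by rewrite coefXn; case: leqP => // ni; case: eqP => //; lia.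
  by rewrite coef0; case: leqP => // ni; case: eqP => //; lia.
case: leqP => [kn|/ltnW kn]; last by rewrite mul0r /ser coef0.
rewrite /ser coefXnM ltnNge kn coef_poly ifT //; lia.
Qed.

Lemma qnI k : injective (fun f => q ^+ k * f).
Proof.
move=> f g /(congr1 (fun (h : fps) n => h (n + k)%N)) fg.
apply/funext => n; have := congr1 (@^~ n) fg; rewrite /= !qnM.
by rewrite ltnNge leq_addl /= addnK.
Qed.

(** * The substitutions q -> q^k and q -> -q *)

(** [dil k f] is f(q^k); for k = 0 the conventions of [%|] and [%/] make it
    the constant term of f, so it is a ring morphism for every k. *)
Definition dil k f : fps := fun n => if (k %| n)%N then f (n %/ k)%N else 0.

Lemma agree_dil k N f g : (0 < k)%N -> agree N f g -> agree N (dil k f) (dil k g).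
Proof.
move=> k0 fg i iN; rewrite /dil; case: ifP => // _; apply: fg.
by apply: leq_ltn_trans iN; apply: leq_div.
Qed.

Lemma dil_ser k p : (0 < k)%N -> dil k (ser p) = ser (p \Po 'X^k).
Proof. by move=> k0; apply/funext => n; rewrite /ser coef_comp_poly_Xn. Qed.

Fact dil_is_zmod_morphism k : zmod_morphism (dil k).
Proof. by move=> f g; apply/funext => n; rewrite /dil !fpsD !fpsN; case: ifP. Qed.

Fact dil_is_monoid_morphism k : monoid_morphism (dil k).
Proof.
split=> [|f g].
  apply/funext => n; rewrite /dil !fps1; case: dvdnP => [[m ->]|].
    case: k => [|k]; first by rewrite muln0.
    by rewrite mulnK // muln_eq0 orbF.
  by case: n => // -[]; exists 0%N.
case: (posnP k) => [->|k0].
  apply/funext => -[|n]; rewrite [RHS]fpsM /dil dvd0n /=.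
    by rewrite [RHS]big_ord1 fpsM big_ord1.
  by rewrite big1 // => i _; rewrite !dvd0n; case: i => -[|i] //= _; rewrite ?mul0r ?mulr0.
apply: fpsP => N.
have tr f' : agree N (dil k f') (ser (trunc N f' \Po 'X^k)).
  rewrite -dil_ser //; apply: agree_dil => // i iN; by rewrite agree_trunc.
move=> n nN; rewrite (agreeM (tr f) (tr g)) // -!rmorphM /= -dil_ser //.
by apply: (agree_dil k0 _ nN); apply: fps_mul_trunc.
Qed.
HB.instance Definition _ k :=
  GRing.isZmodMorphism.Build _ _ (dil k) (dil_is_zmod_morphism k).
HB.instance Definition _ k :=
  GRing.isMonoidMorphism.Build _ _ (dil k) (dil_is_monoid_morphism k).

Lemma dil_q k : (0 < k)%N -> dil k q = q ^+ k.
Proof. by move=> k0; rewrite dil_ser // comp_polyX rmorphXn. Qed.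

Lemma dil_dil j k f : (0 < k)%N -> dil j (dil k f) = dil (j * k) f.
Proof.
move=> k0; apply/funext => n; rewrite /dil.
case: (posnP j) => [->|j0].
  by rewrite mul0n dvd0n; case: eqP => [->|//]; rewrite !div0n dvdn0.
case: dvdnP => [[m ->]|jn].
  by rewrite mulnK // (mulnC m) dvdn_pmul2l // divnMl.
by case: ifP => // /(dvdn_trans (dvdn_mulr k (dvdnn j)))/dvdnP.
Qed.

Lemma dil_inj k : (0 < k)%N -> injective (dil k).
Proof.
move=> k0 f g fg; apply/funext => n; have := congr1 (@^~ (k * n)%N) fg.
by rewrite /dil dvdn_mulr // mulKn.
Qed.

(** This is f(-q). *)
Definition sgn f : fps := fun n => (-1) ^+ n * f n.

Fact sgn_is_zmod_morphism : zmod_morphism sgn.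
Proof. by move=> f g; apply/funext => n; rewrite /sgn !fpsD !fpsN mulrBr. Qed.
Fact sgn_is_monoid_morphism : monoid_morphism sgn.
Proof.
split=> [|f g]; apply/funext => n.
  by rewrite /sgn fps1; case: n => // n; rewrite mulr0.
rewrite /sgn !fpsM mulr_sumr; apply: eq_bigr => i _.
by rewrite mulrACA -exprD subnKC // -ltnS.
Qed.
HB.instance Definition _ := GRing.isZmodMorphism.Build _ _ sgn sgn_is_zmod_morphism.
HB.instance Definition _ := GRing.isMonoidMorphism.Build _ _ sgn sgn_is_monoid_morphism.

Lemma sgnK : involutive sgn.
Proof. by move=> f; apply/funext => n; rewrite /sgn mulrA -expr2 sqrr_sign mul1r. Qed.

Lemma sgn_q : sgn q = - q.
Proof.
apply/funext => n; rewrite /sgn fpsN -(expr1 q) qnE.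
by case: eqP => [->|_]; rewrite ?mulr0 ?oppr0 // expr1 mulN1r.
Qed.

Lemma sgn_dil2 f : sgn (dil 2 f) = dil 2 f.
Proof.
apply/funext => n; rewrite /sgn /dil; case: ifP; rewrite ?mulr0 // dvdn2.
by rewrite -signr_odd => /negbTE->; rewrite mul1r.
Qed.

(** * Gaussian binomials and the finite triple product *)

Section QBinomial.
Variables (R : comNzRingType) (x : R).

Fixpoint qbin N k : R :=
  match N, k with
  | _, 0 => 1
  | 0, _.+1 => 0
  | N'.+1, k'.+1 => qbin N' k' + x ^+ k * qbin N' k
  end.

(** The finite product (x;x)_n. *)
Definition qpoch n : R := \prod_(i < n) (1 - x ^+ i.+1).

Lemma qbin0 N : qbin N 0 = 1.
Proof. by case: N. Qed.

Lemma qbin_small N k : (N < k)%N -> qbin N k = 0.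
Proof.
elim: N k => [|N IH] [|k] //= Nk.
by rewrite !IH ?(ltnW Nk) // mulr0 addr0.
Qed.

Lemma qbin_full N : qbin N N = 1.
Proof. by elim: N => //= N ->; rewrite qbin_small // mulr0 addr0. Qed.

(** The factorial formula, free of division. In the induction step the two
    terms of Pascal's rule contribute the two terms of 1 - x^(n+m+2) = (1 -
    x^(n+1)) + x^(n+1) (1 - x^(m+1)). *)
Lemma qbin_poch n m : qbin (n + m) n * (qpoch n * qpoch m) = qpoch (n + m).
Proof.
have poch0 : qpoch 0 = 1 by rewrite /qpoch big_ord0.
have pochS i : qpoch i.+1 = qpoch i * (1 - x ^+ i.+1) by rewrite /qpoch big_ord_recr.
elim: n m => [|n IHn] m; first by rewrite qbin0 poch0 !mul1r.
elim: m => [|m IHm]; first by rewrite addn0 qbin_full poch0 mul1r mulr1.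
rewrite addSn /= [qpoch (_ + _).+1]pochS mulrDl.
have -> : qbin (n + m.+1) n * (qpoch n.+1 * qpoch m.+1) =
          qpoch (n + m.+1) * (1 - x ^+ n.+1).
  by rewrite -IHn pochS; ring.
have -> : x ^+ n.+1 * qbin (n + m.+1) n.+1 * (qpoch n.+1 * qpoch m.+1) =
          x ^+ n.+1 * qpoch (n + m.+1) * (1 - x ^+ m.+1).
  by rewrite addnS -addSn -IHm [qpoch m.+1]pochS; ring.
have -> : x ^+ (n + m.+1).+1 = x ^+ n.+1 * x ^+ m.+1 by rewrite -exprD.
ring.
Qed.

(** Pascal's rule summed against arbitrary weights: the shape in which it is
    used to multiply an expansion by one more linear factor. *)
Lemma sum_qbinS N (w : nat -> R) :
  \sum_(k < N.+2) qbin N.+1 k * w k =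
  \sum_(k < N.+1) qbin N k * (w k.+1 + x ^+ k * w k).
Proof.
rewrite big_ord_recl qbin0 mul1r.
under eq_bigr do rewrite lift0 /= mulrDl.
rewrite big_split /= addrCA; under [RHS]eq_bigr do rewrite mulrDr.
rewrite [RHS]big_split /=; congr (_ + _).
rewrite [RHS]big_ord_recl big_ord_recr /= qbin_small // mulr0 mul0r addr0.
rewrite qbin0 expr0 !mul1r; congr (_ + _); apply: eq_bigr => i _.
by rewrite ?lift0 /bump ?add1n; ring.
Qed.

(** The binomial coefficient d(d-1)/2 for the integer d = k - n, which may be
    negative; it is the exponent of q in the triple product. *)
Definition tri n k := if (n <= k)%N then 'C(k - n, 2) else 'C((n - k).+1, 2).

Lemma tri0 k : tri 0 k = 'C(k, 2).
Proof. by rewrite /tri subn0. Qed.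

Lemma triSS n k : tri n.+1 k.+1 = tri n k.
Proof. by rewrite /tri ltnS subSS. Qed.

Lemma tri_shift n k : (tri n.+1 k + k = tri n k + n.+1)%N.
Proof.
rewrite /tri; case: (ltngtP k n) => [kn|nk|->].
- rewrite subSn 1?ltnW // [in LHS]binS bin1; lia.
- rewrite -[(k - n)%N]subnSK // binS bin1; lia.
- by rewrite subSnn subnn.
Qed.

(** Cauchy's finite form of the triple product. For n = 0 it is the q-binomial
    theorem, obtained by peeling off the factor 1 + z and replacing z by z x.
    A left factor x^(n+1) + z is then added at a time; it obeys the same
    Pascal rule, so no division by powers of x occurs. *)
Lemma finite_triple_product z n m :
  (\prod_(i < n) (x ^+ i.+1 + z)) * \prod_(i < m) (1 + z * x ^+ i) =
  \sum_(k < (n + m).+1) qbin (n + m) k * (x ^+ tri n k * z ^+ k).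
Proof.
elim: n => [|n IHn]; last first.
  rewrite big_ord_recr /= mulrAC IHn addSn.
  rewrite (sum_qbinS _ (fun k => x ^+ tri n.+1 k * z ^+ k)) mulr_suml.
  apply: eq_bigr => k _; rewrite triSS -mulrA; congr (_ * _).
  by rewrite mulrA -exprD (addnC k) tri_shift exprD (exprS z); ring.
rewrite big_ord0 mul1r add0n; elim: m z => [|m IHm] z.
  by rewrite big_ord0 big_ord1 /= tri0 !mul1r.
rewrite big_ord_recl expr0 mulr1 (sum_qbinS _ (fun k => x ^+ tri 0 k * z ^+ k)).
under eq_bigr => i _ do rewrite lift0 exprS mulrA.
rewrite IHm mulr_sumr; apply: eq_bigr => k _.
by rewrite !tri0 binS bin1 exprMn (exprS z) exprD; ring.
Qed.

End QBinomial.

Lemma rmorph_qbin (R S : comNzRingType) (F : {rmorphism R -> S}) (x : R) N k :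
  F (qbin x N k) = qbin (F x) N k.
Proof.
elim: N k => [|N IH] [|k] /=; rewrite ?rmorph0 ?rmorph1 //.
by rewrite rmorphD rmorphM rmorphXn !IH.
Qed.

(** * Agreement to finite order, cancellation, infinite sums and products *)

Lemma agree_refl N f : agree N f f. Proof. by []. Qed.
Lemma eq_agree N f g : f = g -> agree N f g. Proof. by move->. Qed.
Lemma agree_sym N f g : agree N f g -> agree N g f.
Proof. by move=> fg i /fg. Qed.
Lemma agree_trans N g f h : agree N f g -> agree N g h -> agree N f h.
Proof. by move=> fg gh i iN; rewrite fg ?gh. Qed.
Lemma agree_le M N f g : (N <= M)%N -> agree M f g -> agree N f g.
Proof. by move=> NM fg i iN; apply: fg; apply: leq_trans NM. Qed.
Lemma agreeD N f f' g g' : agree N f f' -> agree N g g' -> agree N (f + g) (f' + g').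
Proof. by move=> ff gg i iN; rewrite !fpsD ff ?gg. Qed.
Lemma agree_sgn N f g : agree N f g -> agree N (sgn f) (sgn g).
Proof. by move=> fg i iN; rewrite /sgn fg. Qed.
Lemma agree_sum N (I : finType) (F G : I -> fps) :
  (forall a, agree N (F a) (G a)) -> agree N (\sum_a F a) (\sum_a G a).
Proof. by move=> FG i iN; rewrite !fps_sum; apply: eq_bigr => j _; apply: FG. Qed.
Lemma agree_qM M N k f g : (N <= k + M)%N -> agree M f g ->
  agree N (q ^+ k * f) (q ^+ k * g).
Proof.
move=> NkM fg i iN; rewrite !qnM; case: leqP => // ki; apply: fg; lia.
Qed.
Lemma agree_qM0 N k f : (N <= k)%N -> agree N (q ^+ k * f) 0.
Proof.
by move=> Nk; rewrite -[0](mulr0 (q ^+ k)); apply: (@agree_qM 0); rewrite ?addn0.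
Qed.

(** Division by a series with constant term 1 preserves divisibility by d on
    any set S of exponents stable under subtracting exponents of that series.
    With d = 0 and S an initial segment this is cancellation to finite order;
    with S a residue class mod k it is division by a series in q^k. *)
Lemma cancel_coef (d : int) (S : pred nat) f g :
  g 0%N = 1 ->
  (forall n j, (j <= n)%N -> g j != 0 -> n \in S -> (n - j)%N \in S) ->
  (forall n, n \in S -> (d %| (f * g) n)%Z) ->
  forall n, n \in S -> (d %| f n)%Z.
Proof.
move=> g0 S_sub fg n; elim/ltn_ind: n => n IH nS.
have := fg n nS; rewrite mulrC fpsM big_ord_recl subn0 g0 mul1r rpredDr //.
apply: rpred_sum => j _; rewrite lift0.
have [->|gj] := eqVneq (g j.+1) 0; first by rewrite mul0r dvdz0.
apply: dvdz_mull; apply: IH; first by have := ltn_ord j; lia.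
exact: S_sub.
Qed.

Lemma agree_cancel N f f' g : g 0%N = 1 -> agree N (f * g) (f' * g) -> agree N f f'.
Proof.
move=> g0 fg n nN; apply/eqP; rewrite -subr_eq0 -fpsN -fpsD -dvd0z.
apply: (@cancel_coef 0 [pred i | (i < N)%N] (f - f') g) => //.
  by move=> i j _ _; rewrite !inE; lia.
by move=> i iN; rewrite mulrBl fpsD fpsN fg // subrr dvd0z.
Qed.

Lemma fps_cancel g f f' : g 0%N = 1 -> f * g = f' * g -> f = f'.
Proof. by move=> g0 fg; apply: fpsP => N; apply: (agree_cancel g0); rewrite fg. Qed.

(** Reading the n-th coefficient off the n-th partial product is correct when
    F k agrees with 1 up to q^k; see [iprodP]. Likewise for [isum], whose k-th
    term must be divisible by q^k. *)
Definition iprod (F : nat -> fps) : fps := fun n => (\prod_(k < n) F k) n.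
Definition isum (F : nat -> fps) : fps := fun n => (\sum_(k < n.+1) F k) n.

Lemma iprodP F M N : (forall k, agree k.+1 (F k) 1) -> (N <= M.+1)%N ->
  agree N (iprod F) (\prod_(k < M) F k).
Proof.
move=> F1 NM; have tail n i : agree n.+1 (\prod_(k < n + i) F k) (\prod_(k < n) F k).
  elim: i => [|i IH]; rewrite ?addn0 // addnS big_ord_recr /= -[X in agree _ _ X]mulr1.
  by apply: agreeM IH _; apply: agree_le (F1 _); rewrite ltnS leq_addr.
move=> n nN; have nM : (n <= M)%N by lia.
by rewrite -(subnKC nM) tail.
Qed.

Lemma isumP F M N : (forall k, agree k (F k) 0) -> (N <= M)%N ->
  agree N (isum F) (\sum_(k < M) F k).
Proof.
move=> F0 NM n nN; rewrite -(subnKC (leq_trans nN NM)) /isum !fps_sum big_split_ord /=.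
rewrite [X in _ = _ + X]big1 ?addr0 // => k _; apply: F0 => /=.
by rewrite ltnS leq_addr.
Qed.

Lemma agree1q k f : agree k (1 + q ^+ k * f) 1.
Proof.
by rewrite -[X in agree _ _ X]addr0; apply: agreeD => //; apply: agree_qM0.
Qed.

(** * The Euler products *)

(** These are (q;q), (-q;q) and (q;q^2), all infinite. *)
Definition Einf := iprod (fun k => 1 - q ^+ k.+1).
Definition Pinf := iprod (fun k => 1 + q ^+ k.+1).
Definition Oinf := iprod (fun k => 1 - q ^+ k.*2.+1).

Lemma EinfP M N : (N <= M.+1)%N -> agree N Einf (\prod_(k < M) (1 - q ^+ k.+1)).
Proof. by apply: iprodP => k; rewrite -mulrN1; apply: agree1q. Qed.
Lemma PinfP M N : (N <= M.+1)%N -> agree N Pinf (\prod_(k < M) (1 + q ^+ k.+1)).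
Proof. by apply: iprodP => k; rewrite -[q ^+ _]mulr1; apply: agree1q. Qed.
Lemma OinfP M N : (N <= M.+1)%N -> agree N Oinf (\prod_(k < M) (1 - q ^+ k.*2.+1)).
Proof.
apply: iprodP => k; apply: (@agree_le k.*2.+1); first by lia.
by rewrite -mulrN1; apply: agree1q.
Qed.

Lemma Einf0 : Einf 0%N = 1. Proof. by rewrite /Einf /iprod big_ord0. Qed.
Lemma Oinf0 : Oinf 0%N = 1. Proof. by rewrite /Oinf /iprod big_ord0. Qed.
Lemma dil_coef0 k f : dil k f 0%N = f 0%N.
Proof. by rewrite /dil dvdn0 div0n. Qed.
Lemma dil_qX k j : (0 < k)%N -> dil k (q ^+ j) = q ^+ (k * j).
Proof. by move=> k0; rewrite rmorphXn /= dil_q // exprM. Qed.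

Lemma Pinf_mul_Einf : Pinf * Einf = dil 2 Einf.
Proof.
apply: fpsP => N; apply: agree_trans (agreeM (PinfP (leqnSn N)) (EinfP (leqnSn N))) _.
rewrite -big_split /=; apply: agree_sym.
apply: agree_trans (agree_dil _ (EinfP (leqnSn N))) _; rewrite // rmorph_prod /=.
apply/eq_agree/eq_bigr => i _.
by rewrite rmorphB rmorph1 /= dil_qX // mulnC exprM; ring.
Qed.

(** Separates the odd and the even factors of (q;q). *)
Lemma Oinf_mul_Einf2 : Oinf * dil 2 Einf = Einf.
Proof.
apply: fpsP => N; apply: agree_trans
  (agreeM (OinfP (leqnSn N)) (agree_dil _ (EinfP (leqnSn N)))) _ => //.
apply: agree_sym; apply: (agree_trans (EinfP (M := N.*2) _)); first by lia.
rewrite rmorph_prod /=; apply: eq_agree; elim: N => [|N IH]; first by rewrite !big_ord0 mulr1.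
rewrite doubleS !big_ord_recr /= IH rmorphB rmorph1 /= dil_qX //.
have -> : (2 * N.+1 = N.*2.+2)%N by lia.
by ring.
Qed.

Lemma Oinf_mul_sgn : Oinf * sgn Oinf = dil 2 Oinf.
Proof.
apply: fpsP => N; apply: agree_trans (agreeM (OinfP (leqnSn N)) (agree_sgn (OinfP (leqnSn N)))) _.
apply: agree_sym; apply: agree_trans (agree_dil _ (OinfP (leqnSn N))) _ => //.
rewrite !rmorph_prod /= -big_split; apply/eq_agree/eq_bigr => i _ /=.
rewrite !rmorphB !rmorph1 /= dil_qX // rmorphXn /= sgn_q exprNn -signr_odd /= odd_double.
by rewrite mulnC exprM; ring.
Qed.

(** Euler: partitions into distinct parts and into odd parts are equinumerous.
    *)
Lemma Pinf_mul_Oinf : Pinf * Oinf = 1.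
Proof.
apply: (@fps_cancel (dil 2 Einf)); first by rewrite dil_coef0 Einf0.
by rewrite -mulrA Oinf_mul_Einf2 Pinf_mul_Einf mul1r.
Qed.

(** * Theta series and their product formulas *)

(** Both signs of the summation index of the square are counted by the factor
    2. *)
Definition phi : fps := 1 + 2%:R * isum (fun k => q ^+ (k.+1 ^ 2)).
Notation phim := (sgn phi).
Definition psi : fps := isum (fun k => q ^+ 'C(k.+1, 2)).
(** The right-hand side of Jacobi's identity for (q;q)^3; see [cube_prod]. *)
Definition jacobi_cube : fps := isum (fun k => ((-1) ^+ k *+ k.*2.+1) * q ^+ 'C(k.+1, 2)).

Lemma agree_qn N k : (N <= k)%N -> agree N (q ^+ k) 0.
Proof. by move=> Nk; rewrite -[q ^+ k]mulr1; apply: agree_qM0. Qed.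

Lemma bin2_ge k : (k <= 'C(k.+1, 2))%N.
Proof. by rewrite binS bin1 leq_addl. Qed.

Lemma psiP M N : (N <= M)%N -> agree N psi (\sum_(k < M) q ^+ 'C(k.+1, 2)).
Proof. by apply: isumP => k; apply: agree_qn; apply: bin2_ge. Qed.

Lemma jacobi_cubeP M N : (N <= M)%N ->
  agree N jacobi_cube (\sum_(k < M) ((-1) ^+ k *+ k.*2.+1) * q ^+ 'C(k.+1, 2)).
Proof.
by apply: isumP => k; rewrite mulrC; apply: agree_qM0; apply: bin2_ge.
Qed.

Lemma phiP M N : (N <= M)%N ->
  agree N phi (1 + 2%:R * \sum_(k < M) q ^+ (k.+1 ^ 2)).
Proof.
move=> NM; apply: agreeD => //; apply: agreeM => //; apply: isumP NM => k.
by apply: agree_qn; nia.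
Qed.

Lemma qpoch_E n N : (N <= n.+1)%N -> agree N (qpoch q n) Einf.
Proof. by move=> nN; apply: agree_sym; apply: EinfP. Qed.

(** In [qbin_poch] each of the three factorials is (q;q) up to the order
    stated, so one factor (q;q) cancels. *)
Lemma qbin_E n m N : (N <= (minn n m).+1)%N ->
  agree N (qbin q (n + m) n * Einf) 1.
Proof.
move=> Nnm; apply: (agree_cancel Einf0); rewrite mul1r -mulrA.
apply: (agree_trans (g := qbin q (n + m) n * (qpoch q n * qpoch q m))).
  by apply: agreeM => //; apply: agreeM; apply/agree_sym/qpoch_E; lia.
by rewrite qbin_poch; apply: qpoch_E; lia.
Qed.

(** The q-adic limit in the finite triple product: a term far from the centre,
    where the binomial is only crudely known, carries a high power of q that
    makes up for the lost precision. *)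
Lemma sum_qbin_E N M (c : nat -> fps) (e : nat -> nat) :
  (forall k, (k <= N)%N -> (M <= e k + (minn k (N - k)).+1)%N) ->
  agree M ((\sum_(k < N.+1) qbin q N k * (c k * q ^+ e k)) * Einf)
          (\sum_(k < N.+1) c k * q ^+ e k).
Proof.
move=> Me; rewrite mulr_suml; apply: agree_sum => -[k kN] /=.
have -> : qbin q N k * (c k * q ^+ e k) * Einf = c k * (q ^+ e k * (qbin q N k * Einf)).
  by ring.
apply: agreeM => //; rewrite -[X in agree _ _ X]mulr1; apply: agree_qM (Me k _) _ => //.
by rewrite -{2}(subnKC (m := k) (n := N)) //; apply: qbin_E.
Qed.

(** Folds a sum about the centre of the triple product, between n and n + 1.
    *)
Lemma sum_fold (V : nmodType) n (F : nat -> V) :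
  \sum_(k < (n + n.+1).+1) F k = \sum_(i < n.+1) (F (n.+1 + i)%N + F (n - i)%N).
Proof.
rewrite -addSn big_split_ord /= addrC big_split /=; congr (_ + _).
rewrite (reindex_inj rev_ord_inj) /=; apply: eq_bigr => i _.
by rewrite subSS.
Qed.

Lemma tri_right n i : tri n (n.+1 + i) = 'C(i.+1, 2).
Proof. by rewrite /tri ifT; [congr 'C(_, 2)|]; lia. Qed.

Lemma tri_left n i : (i <= n)%N -> tri n (n - i) = 'C(i.+1, 2).
Proof.
case: i => [|i] ni; first by rewrite subn0 /tri leqnn subnn.
by rewrite /tri ifF; [congr 'C(_, 2)|]; lia.
Qed.

Lemma tri_large n k : (k <= n + n.+1)%N -> (n.+1 <= tri n k + (minn k (n + n.+1 - k)).+1)%N.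
Proof.
move=> kn; case: (leqP k n) => nk.
  rewrite -(subKn nk) tri_left ?leq_subr //; have := bin2_ge (n - k); lia.
rewrite -(subnKC nk) tri_right; have := bin2_ge (k - n.+1); lia.
Qed.

(** The triple product with z = 1: the two halves of the sum coincide, whence
    the factor 2 cancelled at the start. *)
Lemma psi_prod : psi = Pinf ^+ 2 * Einf.
Proof.
apply: (@natfps_inj 1); apply: fpsP => N /=.
have := finite_triple_product q 1 N N.+1.
rewrite [X in _ * X]big_ord_recl expr0 mulr1.
have -> : \prod_(i < N) (1 + 1 * q ^+ lift ord0 i) = \prod_(i < N) (1 + q ^+ i.+1).
  by apply: eq_bigr => i _; rewrite mul1r lift0.
have -> : \prod_(i < N) (q ^+ i.+1 + 1) = \prod_(i < N) (1 + q ^+ i.+1).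
  by apply: eq_bigr => i _; rewrite addrC.
set A := \prod_(_ < _) _ => JTP.
apply: agree_sym; apply: (agree_trans (g := A * ((1 + 1) * A) * Einf)).
  have -> : A * ((1 + 1) * A) * Einf = 2%:R * (A ^+ 2 * Einf) by ring.
  apply: agreeM => //; apply: agreeM => //; rewrite !expr2.
  by apply: agreeM; apply: PinfP.
rewrite JTP.
under eq_bigr do rewrite expr1n mulr1 -[q ^+ tri _ _]mul1r.
apply: agree_trans (agree_le (leqnSn N) (sum_qbin_E (fun=> 1) (@tri_large N))) _.
rewrite (sum_fold _ (fun k => 1 * q ^+ tri N k)).
apply: (agree_trans (g := 2%:R * \sum_(k < N.+1) q ^+ 'C(k.+1, 2))); last first.
  by apply: agreeM => //; apply/agree_sym/psiP.
apply: eq_agree; rewrite mulr_sumr; apply: eq_bigr => i _.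
rewrite tri_right tri_left -1?ltnS //; ring.
Qed.

(** The derivative in z of the finite triple product at z = -1: exactly one
    factor vanishes there, so only its derivative contributes. *)
Lemma finite_jacobi (R : comNzRingType) (x : R) n :
  (-1) ^+ n.+1 * qpoch x n ^+ 2 =
  \sum_(k < (n + n.+1).+1) qbin x (n + n.+1) k * (((-1) ^+ k *+ k) * x ^+ tri n k).
Proof.
have := congr1 (fun p : {poly R} => p^`().[1])
  (finite_triple_product x%:P (- 'X) n n.+1).
rewrite [X in _ * X]big_ord_recl expr0 mulr1.
set A := \prod_(_ < n) _; set B := \prod_(_ < n) _.
rewrite !derivM derivB derivC derivX.
rewrite !(hornerD, hornerM, hornerN, hornerX, hornerC) subrr !mul0r mulr0 addr0 !add0r.
have -> : A.[1] = (-1) ^+ n * qpoch x n.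
  rewrite /A horner_prod /qpoch -[in (-1) ^+ n](card_ord n) -prodrN.
  apply: eq_bigr => i _.
  by rewrite !(hornerD, hornerM, hornerN, hornerX, hornerC, horner_exp); ring.
have -> : B.[1] = qpoch x n.
  rewrite /B horner_prod; apply: eq_bigr => i _.
  by rewrite lift0 !(hornerD, hornerM, hornerN, hornerX, hornerC, horner_exp); ring.
rewrite raddf_sum horner_sum => JTP.
have -> : (-1) ^+ n.+1 * qpoch x n ^+ 2 = (-1) ^+ n * qpoch x n * (-1 * qpoch x n).
  by rewrite exprS; ring.
rewrite JTP; apply: eq_bigr => k _ /=.
rewrite -rmorph_qbin -rmorphXn mulrA -rmorphM derivM derivC mul0r add0r.
rewrite deriv_exp derivN derivX !(hornerM, hornerMn, hornerC, hornerN, horner_exp, hornerX).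
case: {+}(k : nat) => [|i]; first by rewrite !mulr0n mul0r !mulr0.
by rewrite /= exprS -[in RHS]mulrnAr; ring.
Qed.

(** In [finite_jacobi] the terms k = n + 1 + i and k = n - i have the same
    power of q and opposite signs, and their weights combine to (n + 1 + i) -
    (n - i) = 2 i + 1. *)
Lemma cube_prod : jacobi_cube = Einf ^+ 3.
Proof.
apply: fpsP => N; have JTP := finite_jacobi q N.
apply: agree_sym; apply: (agree_trans (g := qpoch q N ^+ 2 * Einf)).
  rewrite exprSr !expr2; apply: agreeM => //.
  by apply: agreeM; apply/agree_sym/qpoch_E.
have -> : qpoch q N ^+ 2 * Einf = (-1) ^+ N.+1 * ((-1) ^+ N.+1 * qpoch q N ^+ 2 * Einf).
  by rewrite !mulrA -expr2 sqrr_sign mul1r.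
rewrite JTP.
have lim := sum_qbin_E (fun k => (-1) ^+ k *+ k) (@tri_large N).
apply: agree_trans (agreeM (agree_refl _) (agree_le (leqnSn N) lim)) _.
rewrite (sum_fold _ (fun k => (-1) ^+ k *+ k * q ^+ tri N k)).
apply: agree_trans (agree_sym (jacobi_cubeP (leqnSn N))).
apply: eq_agree; rewrite mulr_sumr; apply: eq_bigr => -[i iN] _ /=.
rewrite tri_right tri_left -1?ltnS //.
set s : fps := (-1) ^+ N; have ss : s * s = 1 by rewrite -expr2 sqrr_sign.
have -> : (-1) ^+ (N - i) = s * (-1) ^+ i :> fps.
  by rewrite /s -{2}(subnK (m := i) (n := N)) // exprD -mulrA -expr2 sqrr_sign mulr1.
rewrite exprS exprD exprS -/s mulrnBr // -addnn !mulrSr !mulrnDr; ring: ss.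
Qed.

Lemma bin2_double m : (2 * 'C(m.+1, 2) = m * m.+1)%N.
Proof. elim: m => // m IH; rewrite binS bin1; lia. Qed.

Lemma tri_square n k : (2 * tri n k + k = n + ((k - n) ^ 2 + (n - k) ^ 2))%N.
Proof.
rewrite /tri; case: (ltngtP k n) => [kn|nk|->].
- rewrite bin2_double; nia.
- have -> : k = (n + (k - n.+1).+1)%N by lia.
  by rewrite addKn bin2_double; nia.
- by rewrite subnn bin0n addn0.
Qed.

(** Gauss: the triple product in base q^2 with z = -q. The left factors
    q^(2i+2) - q each contribute a spurious - q, which is why a power of q is
    cancelled. *)
Lemma phi_prod : phim = Oinf ^+ 2 * dil 2 Einf.
Proof.
apply: fpsP => N.
pose o := \prod_(i < N) (1 - q ^+ i.*2.+1).
have JTP : (-1) ^+ N * o ^+ 2 =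
    \sum_(k < (N + N).+1) qbin (q ^+ 2) (N + N) k *
      ((-1) ^+ k * q ^+ ((k - N) ^ 2 + (N - k) ^ 2)).
  (* the powers of q agree after multiplication by q^N, see [tri_square] *)
  apply: (@qnI N) => /=.
  have := finite_triple_product (q ^+ 2) (- q) N N.
  have -> : \prod_(i < N) (1 + - q * q ^+ 2 ^+ i) = o.
    by apply: eq_bigr => i _; rewrite mulNr -exprM -exprS mul2n.
  have -> : \prod_(i < N) (q ^+ 2 ^+ i.+1 + - q) = (- q) ^+ N * o.
    rewrite /o -[N in (- q) ^+ N]card_ord -prodrMl; apply: eq_bigr => i _.
    by rewrite mulrBr mulr1 mulNr -exprS -exprM mulnS mul2n addrC opprK.
  move=> JTP; have -> : q ^+ N * ((-1) ^+ N * o ^+ 2) = (- q) ^+ N * o * o.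
    by rewrite (exprNn q); ring.
  rewrite JTP mulr_sumr; apply: eq_bigr => k _.
  rewrite -exprM (exprNn q) [RHS]mulrCA; congr (_ * _).
  by rewrite mulrCA [RHS]mulrCA -!exprD tri_square.
have JTP' : (-1) ^+ N * o ^+ 2 =
    \sum_(k < (N + N).+1) dil 2 (qbin q (N + N) k) *
      ((-1) ^+ k * q ^+ ((k - N) ^ 2 + (N - k) ^ 2)).
  by rewrite JTP; apply: eq_bigr => k _; rewrite rmorph_qbin /= dil_q.
apply: agree_sym; apply: (agree_trans (g := o ^+ 2 * dil 2 Einf)).
  by apply: agreeM => //; rewrite !expr2; apply: agreeM; apply: OinfP.
have -> : o ^+ 2 = (-1) ^+ N * ((-1) ^+ N * o ^+ 2).
  by rewrite mulrA -expr2 sqrr_sign mul1r.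
rewrite {}JTP' -mulrA.
have step : agree N
   ((\sum_(k < (N + N).+1) dil 2 (qbin q (N + N) k) *
      ((-1) ^+ k * q ^+ ((k - N) ^ 2 + (N - k) ^ 2))) * dil 2 Einf)
   (\sum_(k < (N + N).+1) (-1) ^+ k * q ^+ ((k - N) ^ 2 + (N - k) ^ 2)).
  rewrite mulr_suml; apply: agree_sum => -[k kN] /=.
  rewrite mulrAC -rmorphM /= mulrCA; apply: agreeM => //.
  rewrite mulrC -[X in agree _ _ X]mulr1.
  apply: (@agree_qM (minn k (N + N - k)).+1); first by nia.
  rewrite -(rmorph1 (dil 2)); apply: agree_dil => //=.
  by rewrite -{2}(subnKC (m := k) (n := (N + N)%N)) //; apply: qbin_E.
apply: agree_trans (agreeM (agree_refl _) step) _; apply: agree_sym.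
apply: agree_trans (agree_sgn (phiP (leqnn N))) _; apply: eq_agree.
have -> : \sum_(k < (N + N).+1) (-1) ^+ k * q ^+ ((k - N) ^ 2 + (N - k) ^ 2) =
  (-1) ^+ N * (1 + \sum_(i < N) 2%:R * ((-1) ^+ i.+1 * q ^+ (i.+1 ^ 2))).
  rewrite -addnS big_split_ord /= big_ord_recl /= [X in X + _](reindex_inj rev_ord_inj) /=.
  rewrite addrCA -big_split /= mulrDr; congr (_ + _).
    by rewrite addn0 subnn mulr1.
  rewrite mulr_sumr; apply: eq_bigr => -[i iN] _ /=; rewrite /bump add1n.
  set s : fps := (-1) ^+ N; have ss : s * s = 1 by rewrite -expr2 sqrr_sign.
  have -> : (-1) ^+ (N - i.+1) = s * (-1) ^+ i.+1 :> fps.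
    by rewrite /s -{2}(subnK iN) exprD -mulrA -expr2 sqrr_sign mulr1.
  have -> : ((N - i.+1 - N) ^ 2 + (N - (N - i.+1)) ^ 2 = i.+1 ^ 2)%N by nia.
  have -> : ((N + i.+1 - N) ^ 2 + (N - (N + i.+1)) ^ 2 = i.+1 ^ 2)%N by nia.
  by rewrite exprD -/s; ring: ss.
rewrite mulrA -expr2 sqrr_sign mul1r rmorphD rmorph1 rmorphM rmorph_nat; congr (_ + _).
rewrite rmorph_sum mulr_sumr; apply: eq_bigr => i _ /=; congr (_ * _).
by rewrite rmorphXn /= sgn_q (exprNn q) -[in LHS]signr_odd -[in RHS]signr_odd oddX.
Qed.

Lemma phi_mod2 : exists h, phi = 1 + 2%:R * h.
Proof. by eexists. Qed.

(** * Dissections of theta functions *)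

(** Splits the squares by parity, with (2j+1)^2 = 8 j(j+1)/2 + 1. *)
Lemma phi_dissection : phi = dil 4 phi + 2%:R * q * dil 8 psi.
Proof.
apply: fpsP => N; apply: (agree_trans (phiP (M := N.*2) _)); first by lia.
have dil4 := agree_dil (isT : 0 < 4)%N (phiP (leqnn N)).
have dil8 := agree_dil (isT : 0 < 8)%N (psiP (leqnn N)).
apply: agree_sym; apply: agree_trans (agreeD dil4 (agreeM (agree_refl _) dil8)) _.
apply: eq_agree; rewrite rmorphD rmorph1 rmorphM rmorph_nat !rmorph_sum /=.
elim: N {dil4 dil8} => [|N IH]; first by rewrite !big_ord0; ring.
rewrite doubleS !big_ord_recr /=.
transitivity (1 + 2%:R * (\sum_(i < N.*2) q ^+ (i.+1 ^ 2)) +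
  2%:R * (dil 4 (q ^+ (N.+1 ^ 2)) + q * dil 8 (q ^+ 'C(N.+1, 2)))).
  by rewrite -IH; ring.
rewrite !dil_qX // -exprS.
have -> : (N.*2.+2 ^ 2 = 4 * N.+1 ^ 2)%N by nia.
have -> : (N.*2.+1 ^ 2 = (8 * 'C(N.+1, 2)).+1)%N by have := bin2_double N; nia.
by ring.
Qed.

Lemma phim0 : phim 0%N = 1.
Proof. by rewrite phi_prod expr2 !fpsM !big_ord1 dil_coef0 Einf0 !fpsM !big_ord1 Oinf0. Qed.

(** In [phi_prod], replacing q by -q only affects the factors with odd
    exponents, and these multiply up by [Oinf_mul_sgn]. *)
Lemma phi_phim : phi * phim = dil 2 (phim ^+ 2).
Proof.
have phiE : phi = sgn Oinf ^+ 2 * dil 2 Einf.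
  by rewrite -[phi]sgnK phi_prod rmorphM rmorphXn /= sgn_dil2.
rewrite phi_prod [phi]phiE.
have -> : sgn Oinf ^+ 2 * dil 2 Einf * (Oinf ^+ 2 * dil 2 Einf) =
   (Oinf * sgn Oinf) ^+ 2 * dil 2 Einf ^+ 2 by ring.
rewrite Oinf_mul_sgn -!rmorphXn -rmorphM /=; congr (dil 2 _).
by rewrite -{1}Oinf_mul_Einf2; ring.
Qed.

Lemma sgn_dil4 f : sgn (dil 4 f) = dil 4 f.
Proof. by rewrite -[4%N]/(2 * 2)%N -dil_dil // sgn_dil2. Qed.
Lemma sgn_dil8 f : sgn (dil 8 f) = dil 8 f.
Proof. by rewrite -[8%N]/(2 * 4)%N -dil_dil // sgn_dil2. Qed.

Lemma phim_dissection : phim = dil 4 phi - 2%:R * q * dil 8 psi.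
Proof.
rewrite {1}phi_dissection rmorphD !rmorphM rmorph_nat /= sgn_dil4 sgn_dil8 sgn_q.
ring.
Qed.

(** The product phi(q) phi(-q) computed from the parity splitting is
    phi(q^4)^2 - 4 q^2 psi(q^8)^2; compared with [phi_phim] this determines
    phi(-q)^2, and q -> -q gives the claim. *)
Lemma phi_sq : phi ^+ 2 = dil 2 phi ^+ 2 + 4%:R * q * dil 4 psi ^+ 2.
Proof.
suff phim_sq : phim ^+ 2 = dil 2 phi ^+ 2 - 4%:R * q * dil 4 psi ^+ 2.
  rewrite -[LHS]sgnK rmorphXn /= phim_sq.
  rewrite rmorphB !(rmorph_nat, rmorphXn, rmorphM) /= sgn_dil2 sgn_dil4 sgn_q.
  by ring.
apply: (@dil_inj 2) => //; rewrite -phi_phim {1}phi_dissection phim_dissection.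
rewrite rmorphB !(rmorph_nat, rmorphXn, rmorphM) /= !dil_dil // dil_q //.
by ring.
Qed.

(** Squaring the parity splitting directly and comparing with two applications
    of [phi_sq] leaves the odd part 4 q phi(q^4) psi(q^8) = 4 q psi(q^4)^2 of
    phi(q)^2. *)
Lemma phi_psi : phi * dil 2 psi = psi ^+ 2.
Proof.
apply: (@dil_inj 4) => //; apply: (@natfps_inj 3); apply: (@qnI 1) => /=.
rewrite rmorphM rmorphXn /= dil_dil //.
have := phi_sq; rewrite {1}phi_dissection.
have := congr1 (dil 2) phi_sq.
rewrite rmorphD !(rmorph_nat, rmorphXn, rmorphM) /= !dil_dil // dil_q // => -> E.
(* the even part of phi^2, removed from both sides *)
apply: (addrI (dil 4 phi ^+ 2 + 4%:R * q ^+ 2 * dil 8 psi ^+ 2)).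
rewrite expr1; transitivity ((dil 4 phi + 2%:R * q * dil 8 psi) ^+ 2); first by ring.
by rewrite E; ring.
Qed.

Lemma psi_phim : psi * phim ^+ 2 = jacobi_cube.
Proof.
rewrite psi_prod phi_prod cube_prod.
transitivity ((Pinf * Oinf) ^+ 2 * Einf * (Oinf * dil 2 Einf) ^+ 2); first by ring.
by rewrite Pinf_mul_Oinf Oinf_mul_Einf2; ring.
Qed.

(** * Vanishing along arithmetic progressions *)

Definition in_class k r n := n == r %[mod k].
Definition vanish (d : int) k r f := forall n, in_class k r n -> (d %| f n)%Z.

Lemma vanishD d k r f g : vanish d k r f -> vanish d k r g -> vanish d k r (f + g).
Proof. by move=> Vf Vg n nr; rewrite fpsD rpredD ?Vf ?Vg. Qed.

Lemma vanish_nat d m k r f : (d %| m%:Z)%Z -> vanish d k r (m%:R * f).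
Proof. by move=> dm n _; rewrite fps_natM dvdz_mulr // natz. Qed.

Lemma vanish_class d k r j s f : (k %| r)%N -> s != j %[mod k] ->
  vanish d r s (q ^+ j * dil k f).
Proof.
move=> kr sj n nr; rewrite qnM; case: leqP => jn; last exact: dvdz0.
rewrite /dil ifF ?dvdz0 //; apply: contra_neqF sj => kn.
move: nr => /eqP /(congr1 (modn^~ k)) /=; rewrite !modn_dvdm // => <-.
by apply/eqP; rewrite eqn_mod_dvd.
Qed.

Lemma in_class_sub k r j n : (j <= n)%N -> (k %| j)%N -> in_class k r n -> in_class k r (n - j).
Proof.
move=> jn kj; rewrite /in_class => /eqP <-.
by rewrite eq_sym eqn_mod_dvd ?leq_subr // subKn.
Qed.

Lemma vanish_dil d k r f g : vanish d k r f -> vanish d k r (f * dil k g).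
Proof.
move=> Vf n nr; rewrite mulrC fpsM; apply: rpred_sum => -[j jn] _ /=.
rewrite /dil; case: ifP => kj; last by rewrite mul0r dvdz0.
by apply: dvdz_mull; apply: Vf; apply: in_class_sub.
Qed.

Lemma vanish_cancel d k r f g : g 0%N = 1 ->
  vanish d k r (f * dil k g) -> vanish d k r f.
Proof.
move=> g0 V; apply: (@cancel_coef d (in_class k r) f (dil k g)) => //.
  by rewrite dil_coef0.
move=> n j jn; rewrite /dil; case: ifP => [kj _|_]; last by rewrite eqxx.
exact: in_class_sub.
Qed.

(** * Reciprocal of phi(-q)^2 and its coefficients *)

(** Repeated use of phi(q) phi(-q) = phi(-q^2)^2 turns F = 1 / phi(-q)^2 into
    phi(q)^2 phi(q^2)^4 / phi(-q^4)^8. With a = phi(q^4)^2, b = psi(q^8)^2, c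
    = psi(q^4)^2 the numerator is (a + 4 q^2 b + 4 q c) (a + 4 q^2 b)^2, in
    which the exponents 3 mod 4 come from 4 q c times 8 q^2 a b only, and a b
    = c^2 by [phi_psi]. *)
Lemma four_dissection F : F * phim ^+ 2 = 1 ->
  exists U0 U1 U2, F * dil 4 (phim ^+ 8) =
  dil 4 U0 + q * dil 4 U1 + q ^+ 2 * dil 4 U2 + 32%:R * (q ^+ 3 * dil 4 (psi ^+ 6)).
Proof.
move=> F1.
have E1 : F * dil 4 (phim ^+ 8) = phi ^+ 2 * (dil 2 phi ^+ 2) ^+ 2.
  transitivity (F * phim ^+ 2 * phi ^+ 2 * (dil 2 phi ^+ 2) ^+ 2); last by rewrite F1 mul1r.
  have -> : phim ^+ 8 = (phim ^+ 2) ^+ 4 by rewrite -exprM.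
  have dil4 f : dil 4 f = dil 2 (dil 2 f) by rewrite dil_dil.
  rewrite rmorphXn /= dil4 -phi_phim.
  rewrite rmorphM /=.
  have E2 : phi ^+ 2 * phim ^+ 2 = dil 2 phim ^+ 4.
    by rewrite -exprMn phi_phim rmorphXn -exprM.
  transitivity (F * dil 2 phi ^+ 4 * dil 2 phim ^+ 4); first by ring.
  by rewrite -E2; ring.
have E2 : dil 2 phi ^+ 2 = dil 4 phi ^+ 2 + 4%:R * q ^+ 2 * dil 8 psi ^+ 2.
  rewrite -rmorphXn /= phi_sq rmorphD !(rmorph_nat, rmorphXn, rmorphM) /= !dil_dil // dil_q //.
have E3 : psi ^+ 6 = phi ^+ 2 * psi ^+ 2 * dil 2 psi ^+ 2.
  transitivity ((phi * dil 2 psi) ^+ 2 * psi ^+ 2); first by rewrite phi_psi; ring.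
  by ring.
rewrite E1 phi_sq E2 {}E3.
set a := phi ^+ 2; set b := dil 2 psi ^+ 2; set c := psi ^+ 2.
have -> : dil 4 phi ^+ 2 = dil 4 a by rewrite rmorphXn.
have -> : dil 8 psi ^+ 2 = dil 4 b by rewrite rmorphXn /= dil_dil.
have -> : dil 4 psi ^+ 2 = dil 4 c by rewrite rmorphXn.
have Q4 : q ^+ 4 = dil 4 q by rewrite dil_q.
(* the expansion of (a + 4 q^2 b + 4 q c) (a + 4 q^2 b)^2, sorted by exponent mod 4 *)
exists (a ^+ 3 + 48%:R * q * a * b ^+ 2),
 (4%:R * c * a ^+ 2 + 64%:R * q * b ^+ 2 * c),
 (12%:R * a ^+ 2 * b + 64%:R * q * b ^+ 3).
rewrite !rmorphD !(rmorph_nat, rmorphXn, rmorphM) /= -Q4.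
by ring.
Qed.

(** Only the coefficients up to a given order matter, so f may be replaced by
    a polynomial over F_k, where the k-th power map is additive. *)
Lemma frobenius f k : prime k -> exists h, f ^+ k = dil k f + k%:R * h.
Proof.
move=> k_prime; have k0 := prime_gt0 k_prime; have charF := pchar_Fp k_prime.
suff dvd n : (k %| (f ^+ k - dil k f) n)%Z.
  exists (fun n => ((f ^+ k - dil k f) n %/ k)%Z); apply/funext => n.
  rewrite fpsD fps_natM mulrC natz divzK // fpsD fpsN addrCA subrr addr0 //.
pose p : {poly int} := trunc n.+1 f; have fp : agree n.+1 (ser p) f by apply: agree_trunc.
have -> : (f ^+ k - dil k f) n = (p ^+ k - (p \Po 'X^k))`_n.
  rewrite fpsD fpsN coefB; congr (_ - _); last first.
    rewrite -[RHS]/(ser _ n) -dil_ser //.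
    exact: (agree_sym (agree_dil k0 fp)).
  rewrite -[RHS]/(ser _ n) rmorphXn.
  exact: (agree_sym (agreeX k fp)).
rewrite (dvdz_pcharf charF) -[_%:~R](coef_map (intr : {rmorphism int -> 'F_k})).
rewrite rmorphB rmorphXn /= comp_polyE.
have charP : k \in [pchar {poly 'F_k}] by rewrite pchar_poly.
suff -> : (map_poly intr p : {poly 'F_k}) ^+ k =
          map_poly intr (\sum_(i < size p) p`_i *: 'X^k ^+ i) by rewrite subrr coef0.
rewrite -(pFrobenius_autE charP) -[p in LHS]coefK poly_def !rmorph_sum /=.
apply: eq_bigr => i _; rewrite !linearZ /= map_polyXn -!mul_polyC rmorphM /=.
rewrite rmorph_int pFrobenius_aut_int; congr (_ * _).
by rewrite pFrobenius_autE rmorphXn /= map_polyXn -!exprM mulnC.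
Qed.

(** If n = k(k+1)/2 then 8n + 1 = (2k+1)^2, and 8n + 1 is not a nonzero square
    modulo 5 when n is 2, 3 or 4 modulo 5; so 5 divides 2k+1, the coefficient.
    *)
Lemma cube_coef n : (n %% 5 \in [:: 2; 3; 4])%N -> (5 %| jacobi_cube n)%Z.
Proof.
move=> n5; rewrite /jacobi_cube /isum fps_sum; apply: rpred_sum => -[k kn] _ /=.
rewrite mulrC qnM; case: leqP => kC; last exact: dvdz0.
rewrite fpsMn -signr_odd.
have [n_tri|n_tri] := eqVneq n 'C(k.+1, 2); last first.
  have n_neq : (n - 'C(k.+1, 2))%N != 0%N by lia.
  by case: (odd k); rewrite ?expr1 ?expr0 ?fpsN fps1 (negbTE n_neq) ?oppr0 mul0rn dvdz0.
have k5 : (5 %| k.*2.+1)%N.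
  have := bin2_double k; rewrite -n_tri {n_tri kn}.
  rewrite (divn_eq k 5); move: (k %/ 5)%N (ltn_pmod k (isT : 0 < 5)%N) => a.
  rewrite (divn_eq n 5); move: n5 (n %/ 5)%N; rewrite !inE => /or3P[] /eqP -> c.
  - by case: (k %% 5)%N => [|[|[|[|[|b]]]]] // _; lia.
  - by case: (k %% 5)%N => [|[|[|[|[|b]]]]] // _; lia.
  - by case: (k %% 5)%N => [|[|[|[|[|b]]]]] // _; lia.
rewrite -[_ *+ k.*2.+1]mulr_natr; apply: dvdz_mull.
by rewrite natz.
Qed.

Definition eqm m f g := exists h, f = g + m%:R * h.

Lemma eqm_refl m f : eqm m f f.
Proof. by exists 0; rewrite mulr0 addr0. Qed.

Lemma eqmM m f f' g g' : eqm m f f' -> eqm m g g' -> eqm m (f * g) (f' * g').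
Proof. by move=> [a ->] [b ->]; exists (f' * b + a * g' + m%:R * a * b); ring. Qed.

Lemma eqmX m k f g : eqm m f g -> eqm m (f ^+ k) (g ^+ k).
Proof.
by move=> fg; elim: k => [|k IH]; [apply: eqm_refl | rewrite !exprS; apply: eqmM].
Qed.

Lemma eqm_dil m k f g : eqm m f g -> eqm m (dil k f) (dil k g).
Proof. by move=> [h ->]; exists (dil k h); rewrite rmorphD rmorphM rmorph_nat. Qed.

Lemma vanish_eqm m k r f g : eqm m f g -> vanish m k r g -> vanish m k r f.
Proof. by move=> [h ->] V; apply: vanishD => //; apply: vanish_nat. Qed.

Lemma eqm_sym m f g : eqm m f g -> eqm m g f.
Proof. by move=> [h ->]; exists (- h); ring. Qed.

Lemma fpsX_coef0 f k : (f ^+ k) 0%N = f 0%N ^+ k.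
Proof. by elim: k => // k IH; rewrite !exprS fpsM big_ord1 IH. Qed.

Lemma vanish_low d U0 U1 U2 s : (s %% 4 = 3)%N ->
  vanish d 4 s (dil 4 U0 + q * dil 4 U1 + q ^+ 2 * dil 4 U2).
Proof.
move=> s3; rewrite -[dil 4 U0]mul1r -[X in _ + X * _ + _]expr1 -(expr0 q).
by do ![apply: vanishD]; apply: vanish_class => //; rewrite s3.
Qed.

Lemma vanish_refine d k m r f : (k %| m)%N -> vanish d k r f -> vanish d m r f.
Proof.
move=> km V n /eqP nr; apply: V; apply/eqP.
by rewrite -(modn_dvdm n km) nr modn_dvdm.
Qed.

(** Multiplying by phi(q^4)^8 turns phi(-q^4)^8 into phi(-q^8)^16, a series in
    q^8, at the cost of a factor that is 1 modulo 2. *)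
Lemma vanish64 F : F * phim ^+ 2 = 1 -> vanish 64 8 7 F.
Proof.
move=> Fphi.
have [U0 [U1 [U2 E]]] := four_dissection Fphi.
have psi6 : eqm 2 (psi ^+ 6) (dil 2 (psi ^+ 3)).
  by rewrite (exprM _ 2 3) rmorphXn; apply: eqmX; apply: frobenius.
have phi8 : eqm 2 (phi ^+ 8) 1.
  by rewrite -(expr1n _ 8); apply: eqmX; have [h ->] := phi_mod2; exists h.
have [h Eh] : eqm 2 (dil 4 (psi ^+ 6 * phi ^+ 8)) (dil 8 (psi ^+ 3)).
  rewrite (_ : 8%N = (4 * 2)%N) // -dil_dil // -[dil 2 _]mulr1.
  by apply: eqm_dil; apply: eqmM.
apply: (@vanish_cancel _ _ _ _ (phim ^+ 16)).
  by rewrite fpsX_coef0 phim0 expr1n.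
have -> : F * dil 8 (phim ^+ 16) =
  (dil 4 U0 + q * dil 4 U1 + q ^+ 2 * dil 4 U2) * dil 4 (phi ^+ 8) +
  32%:R * (q ^+ 3 * dil 8 (psi ^+ 3)) + 64%:R * (q ^+ 3 * h).
  have -> : dil 8 (phim ^+ 16) = dil 4 (phim ^+ 8) * dil 4 (phi ^+ 8).
    transitivity (dil 4 ((phi * phim) ^+ 8)); last by rewrite -rmorphM exprMn mulrC.
    have -> : (phi * phim) ^+ 8 = dil 2 (phim ^+ 16).
      by rewrite phi_phim -(rmorphXn _ 8) /= -exprM.
    by rewrite dil_dil.
  rewrite mulrA E mulrDl -[RHS]addrA; congr (_ + _).
  (* the error term 2 h is absorbed as 32 * 2 = 64 *)
  transitivity (32%:R * q ^+ 3 * (dil 8 (psi ^+ 3) + 2%:R * h)); last by ring.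
  by rewrite -Eh rmorphM /=; ring.
apply: vanishD; last exact: vanish_nat.
apply: vanishD; first by apply: (@vanish_refine _ 4) => //; apply: vanish_dil; apply: vanish_low.
have -> : 32%:R * (q ^+ 3 * dil 8 (psi ^+ 3)) = q ^+ 3 * dil 8 (32%:R * psi ^+ 3).
  by rewrite [in RHS]rmorphM rmorph_nat; ring.
exact: vanish_class.
Qed.

Lemma vanish_cube r : r \in [:: 11; 15; 19]%N -> vanish 5 20 r (q ^+ 3 * dil 4 jacobi_cube).
Proof.
move=> rR n /eqP nr; rewrite qnM; case: leqP => n3; last exact: dvdz0.
rewrite /dil; case: dvdnP => [[m nm]|_]; last exact: dvdz0.
rewrite nm mulnK //; apply: cube_coef; have {n3}En : n = (m * 4 + 3)%N by lia.
by move: rR nr; rewrite En !inE => /or3P[] /eqP-> nr; apply/or3P;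
  [apply: Or31 | apply: Or32 | apply: Or33]; apply/eqP; lia.
Qed.

(** The exponent 10 = 8 + 2 serves twice: phi(-q^4)^10 is a series in q^20
    modulo 5, and the extra square combines with one of the six factors
    psi(q^4) to Jacobi's cube. *)
Lemma vanish5 F r : F * phim ^+ 2 = 1 -> r \in [:: 11; 15; 19]%N ->
  vanish 5 20 r F.
Proof.
move=> Fphi rR; have r3 : (r %% 4 = 3)%N by move: rR; rewrite !inE => /or3P[] /eqP->.
have [U0 [U1 [U2 E]]] := four_dissection Fphi.
have dil20 f : dil 20 f = dil 4 (dil 5 f) by rewrite dil_dil.
apply: (@vanish_cancel _ _ _ _ (phim ^+ 2)); first by rewrite fpsX_coef0 phim0 expr1n.
apply: (@vanish_eqm _ _ _ _ (F * dil 4 (phim ^+ 10))).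
  apply: eqmM; first exact: eqm_refl.
  rewrite dil20 rmorphXn (exprM _ 5 2); apply/eqm_dil/eqm_sym/eqmX.
  exact: frobenius.
have -> : F * dil 4 (phim ^+ 10) =
  (dil 4 U0 + q * dil 4 U1 + q ^+ 2 * dil 4 U2) * dil 4 (phim ^+ 2) +
  32%:R * (q ^+ 3 * dil 4 jacobi_cube) * dil 4 (psi ^+ 5).
  rewrite (exprD _ 8 2) rmorphM mulrA E mulrDl; congr (_ + _).
  by rewrite -psi_phim (exprSr _ 5) !rmorphM /=; ring.
apply: vanishD.
  by apply: (@vanish_refine _ 4) => //; apply: vanish_dil; apply: vanish_low.
apply: (@vanish_eqm _ _ _ _ (32%:R * (q ^+ 3 * dil 4 jacobi_cube) * dil 20 psi)).
  by apply: eqmM; rewrite ?dil20; [apply: eqm_refl | apply/eqm_dil/frobenius].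
by apply: vanish_dil => n nr; rewrite fps_natM; apply: dvdz_mull; apply: vanish_cube nr.
Qed.

(** * Generating functions of overpartitions and of pairs *)

Implicit Types (s t : seq (nat * bool)).

Definition overpartitions n : seq (seq (nat * bool)) :=
  [seq nat_parts u | u <- enum [pred u : bounded_parts n |
     overpartition (nat_parts u) && (weight (nat_parts u) == n)]].

Lemma overpartitions_uniq n : uniq (overpartitions n).
Proof. by rewrite map_inj_uniq ?enum_uniq //; apply: nat_parts_inj. Qed.

Lemma mem_overpartitions n s :
  (s \in overpartitions n) = overpartition s && (weight s == n).
Proof.
apply/mapP/andP => [[u]|[s_ov /eqP ws]].
  by rewrite mem_enum inE => /andP[? ?] ->.
have [u us] := nat_parts_surj s_ov (eq_leq ws).
by exists u; rewrite ?mem_enum ?inE us ?s_ov ?ws /=.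
Qed.

Definition part_le m : pred (nat * bool) := fun x => (x.1 <= m)%N.
(** What may follow a part of size m in an overpartition. *)
Definition part_le_plain m : pred (nat * bool) :=
  fun x => (x.1 <= m)%N && (x.2 ==> (x.1 != m)).

Definition parts_gf (Q : pred (nat * bool)) : fps :=
  fun n => (count (all Q) (overpartitions n))%:Z.

Lemma overpartition_cons k b t :
  overpartition ((k, b) :: t) = [&& (0 < k)%N, overpartition t & all (part_le_plain k) t].
Proof.
rewrite /overpartition /= -!andbA; congr [&& _, _ & _].
by rewrite andbC; congr (_ && all _ _).
Qed.

Lemma weight_cons k b t : weight ((k, b) :: t) = (k + weight t)%N.
Proof. by rewrite /weight big_cons. Qed.

(** The head is the largest part, so the bound on it decides. *)
Lemma all_part_le m k b t : overpartition ((k, b) :: t) ->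
  all (part_le m) ((k, b) :: t) = (k <= m)%N.
Proof.
rewrite overpartition_cons => /and3P[_ _ tk]; rewrite /= andb_idr // => km.
by apply: sub_all tk => x /andP[xk _]; apply: leq_trans km.
Qed.

(** An overlined part equal to the head is excluded in the tail already, so
    only the head matters. *)
Lemma all_part_le_plain m k b t : overpartition ((k, b) :: t) ->
  all (part_le_plain m) ((k, b) :: t) = part_le_plain m (k, b).
Proof.
rewrite overpartition_cons => /and3P[_ _ tk]; rewrite /= andb_idr // => /andP[/= km _].
apply: sub_all tk => x /andP[xk xb]; rewrite /part_le_plain (leq_trans xk km) /=.
apply/implyP => x2; have := implyP xb x2; apply: contra_neq => xm; lia.
Qed.

Definition head_is (x : nat * bool) s := ohead s == Some x.

(** Removing the head m+1 is a bijection onto overpartitions with parts in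
    [part_le_plain m.+1]. *)
Lemma count_head n m b (Q : pred (nat * bool)) :
  Q (m.+1, b) -> subpred (part_le_plain m.+1) Q ->
  (count (fun s => all Q s && head_is (m.+1, b) s) (overpartitions n))%:Z =
  (q ^+ m.+1 * parts_gf (part_le_plain m.+1)) n.
Proof.
move=> Qm Qsub; rewrite qnM; case: leqP => mn.
  rewrite /parts_gf.
  have -> : count (all (part_le_plain m.+1)) (overpartitions (n - m.+1)) =
      size [seq (m.+1, b) :: t | t <- overpartitions (n - m.+1) & all (part_le_plain m.+1) t].
    by rewrite size_map size_filter.
  rewrite -size_filter; congr (_%:Z); apply/perm_size/uniq_perm.
  - by rewrite filter_uniq ?overpartitions_uniq.
  - by rewrite map_inj_uniq ?filter_uniq ?overpartitions_uniq // => ? ? [].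
  move=> s; rewrite mem_filter mem_overpartitions; apply/idP/mapP => [|[t]].
    case: s => [|x t]; first by rewrite /head_is andbF.
    rewrite /head_is /= => /andP[/andP[_ /eqP[->]]].
    rewrite overpartition_cons weight_cons => /andP[/and3P[_ t_ov tm] /eqP wt].
    by exists t; rewrite // mem_filter tm mem_overpartitions t_ov; apply/eqP; lia.
  rewrite mem_filter mem_overpartitions => /and3P[tm t_ov /eqP wt] ->.
  rewrite overpartition_cons weight_cons /head_is /= Qm (sub_all Qsub tm) t_ov tm eqxx /=.
  by apply/eqP; lia.
rewrite (@eq_in_count _ _ pred0) ?count_pred0 // => s.
rewrite mem_overpartitions => /andP[_ /eqP ws]; apply/negP => /andP[_].
case: s ws => // -[k c] t; rewrite weight_cons /head_is => wn /eqP[kE _]; lia.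
Qed.

Lemma count_sum (T : Type) (P : pred T) (r : seq T) : count P r = (\sum_(x <- r) P x)%N.
Proof. by rewrite -sum1_count big_mkcond; apply: eq_bigr => x _; case: (P x). Qed.

Lemma parts_gf_le_plain m :
  parts_gf (part_le_plain m.+1) =
  parts_gf (part_le m) + q ^+ m.+1 * parts_gf (part_le_plain m.+1).
Proof.
apply/funext => n; rewrite fpsD -(@count_head n m false (part_le_plain m.+1)) //; last first.
  by rewrite /part_le_plain /= leqnn.
rewrite -PoszD !count_sum -big_split; congr (_%:Z) => /=.
rewrite count_sum; apply: eq_big_seq => s; rewrite mem_overpartitions => /andP[s_ov _].
case: s s_ov => // -[k b] t s_ov; rewrite all_part_le // all_part_le_plain // /head_is /=.
rewrite /part_le_plain /= -[Some _ == _]/((k, b) == (m.+1, false)) xpair_eqE.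
by case: (ltngtP k m.+1) => [km|km|->]; case: b s_ov => _ /=; lia.
Qed.

Lemma parts_gf_leS m :
  parts_gf (part_le m.+1) =
  parts_gf (part_le m) + 2%:R * q ^+ m.+1 * parts_gf (part_le_plain m.+1).
Proof.
have sub : subpred (part_le_plain m.+1) (part_le m.+1) by move=> x /andP[].
apply/funext => n; rewrite -mulrA mulr2n mulrDl mul1r addrA !fpsD.
pose c b := count (fun s => all (part_le m.+1) s && head_is (m.+1, b) s) (overpartitions n).
have cE b : (c b)%:Z = (q ^+ m.+1 * parts_gf (part_le_plain m.+1)) n.
  by apply: count_head => //=; rewrite /part_le /=.
transitivity (parts_gf (part_le m) n + (c true)%:Z + (c false)%:Z); last by rewrite !cE.
rewrite -!PoszD /c !count_sum -!big_split; congr (_%:Z) => /=.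
rewrite count_sum; apply: eq_big_seq => s; rewrite mem_overpartitions => /andP[s_ov _].
case: s s_ov => // -[k b] t s_ov; rewrite !all_part_le // /head_is /=.
rewrite -![Some _ == _]/((k, b) == (m.+1, _)) !xpair_eqE.
by case: (ltngtP k m.+1) => [km|km|->]; case: b s_ov => _ /=; lia.
Qed.

Lemma parts_gf_le0 : parts_gf (part_le 0) = 1.
Proof.
apply/funext => n; rewrite fps1 /parts_gf natz; congr (_%:Z).
have -> : count (all (part_le 0)) (overpartitions n) = count_mem [::] (overpartitions n).
  apply: eq_in_count => -[|[k b] t]; rewrite mem_overpartitions => /andP[s_ov _] //.
  by move: (s_ov); rewrite all_part_le // overpartition_cons => /and3P[]; case: k s_ov.
rewrite count_uniq_mem ?overpartitions_uniq // mem_overpartitions /weight big_nil.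
by rewrite /overpartition /= eq_sym.
Qed.

(** By [parts_gf_leS] and [parts_gf_le_plain], allowing parts m+1 multiplies
    the generating function by (1 + q^(m+1)) / (1 - q^(m+1)). *)
Lemma parts_gf_le m :
  parts_gf (part_le m) * \prod_(k < m) (1 - q ^+ k.+1) = \prod_(k < m) (1 + q ^+ k.+1).
Proof.
elim: m => [|m IH]; first by rewrite !big_ord0 parts_gf_le0 mulr1.
rewrite !big_ord_recr /= -IH parts_gf_leS.
have B : parts_gf (part_le_plain m.+1) * (1 - q ^+ m.+1) = parts_gf (part_le m).
  by rewrite mulrBr mulr1 {1}parts_gf_le_plain; ring.
set A := parts_gf (part_le m) in B *; set p := \prod_(k < m) _.
transitivity (A * p * (1 - q ^+ m.+1) +
  2%:R * q ^+ m.+1 * p * (parts_gf (part_le_plain m.+1) * (1 - q ^+ m.+1))); first by ring.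
by rewrite B; ring.
Qed.

Definition overp_gf : fps := fun n => (size (overpartitions n))%:Z.

(** All parts of an overpartition of n are at most N once n <= N, so bounding
    the parts by N changes nothing up to that order. *)
Lemma overp_gf_E : overp_gf * Einf = Pinf.
Proof.
apply: fpsP => N; apply: agree_sym; apply: agree_trans (PinfP (leqnSn N)) _.
rewrite -parts_gf_le; apply: agree_sym; apply: agreeM; last exact: EinfP.
move=> n nN; rewrite /overp_gf /parts_gf; congr (_%:Z); apply/esym/eqP.
rewrite -all_count; apply/allP => s; rewrite mem_overpartitions => /andP[_ /eqP ws].
apply/allP => x xs; rewrite /part_le (leq_trans _ (ltnW nN)) // -ws.
by rewrite /weight (big_rem x) //= leq_addr.
Qed.

Lemma pp_bar_conv n : (pp_bar n)%:Z = (overp_gf ^+ 2) n.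
Proof.
have [r [r_uniq r_mem <-]] := pp_bar_count n.
rewrite expr2 fpsM -sum1_size.
have -> : (\sum_(x <- r) 1 = \sum_(i < n.+1) \sum_(x <- r) (weight x.1 == i))%N.
  rewrite exchange_big; apply: eq_big_seq => x; rewrite r_mem => /and3P[_ _ /eqP wx].
  have wn : (weight x.1 < n.+1)%N by rewrite ltnS -wx leq_addr.
  rewrite (bigD1 (Ordinal wn)) //= eqxx big1 // => i; rewrite -val_eqE /= eq_sym.
  by move=> /negbTE->.
rewrite -natz natr_sum; apply: eq_bigr => i _; rewrite natz -count_sum -size_filter.
rewrite /overp_gf -PoszM -(size_allpairs (fun a b => (a, b))); congr (_%:Z).
apply/perm_size/uniq_perm; first exact: filter_uniq.
  by rewrite allpairs_uniq ?overpartitions_uniq // => -[a b] [c d].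
move=> [a b]; rewrite mem_filter r_mem /overpartition_pair /=.
apply/idP/allpairsP => [|[[c d] /= []]].
  move=> /and4P[/eqP wa a_ov b_ov /eqP wab]; exists (a, b); split; rewrite //= mem_overpartitions.
    by rewrite a_ov wa eqxx.
  by rewrite b_ov; apply/eqP; lia.
rewrite !mem_overpartitions => /andP[c_ov /eqP wc] /andP[d_ov /eqP wd] [-> ->].
by rewrite c_ov d_ov wc wd eqxx /= subnKC // -ltnS.
Qed.

Definition pp_gf : fps := fun n => (pp_bar n)%:Z.

(** The generating function of overpartitions is (-q;q) / (q;q), whose inverse
    is phi(-q) by [phi_prod] and Euler's identity [Pinf_mul_Oinf]. *)
Lemma pp_gf_phi : pp_gf * phim ^+ 2 = 1.
Proof.
have -> : pp_gf = overp_gf ^+ 2 by apply/funext => n; apply: pp_bar_conv.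
rewrite phi_prod.
transitivity ((overp_gf * (Oinf * (Oinf * dil 2 Einf))) ^+ 2); first by ring.
rewrite Oinf_mul_Einf2; transitivity ((overp_gf * Einf * Oinf) ^+ 2); first by ring.
by rewrite overp_gf_E Pinf_mul_Oinf expr1n.
Qed.

Lemma pp_bar_dvd d k r n : vanish d%:Z k r pp_gf ->
  (pp_bar (k * n + r) = 0 %[mod d])%N.
Proof.
move=> /(_ (k * n + r)%N); rewrite /in_class mulnC modnMDl eqxx => /(_ isT).
by rewrite mod0n => /eqP.
Qed.

Local Close Scope ring_scope.

Theorem corollary2p1 (n : nat) :
  [/\ pp_bar (8 * n + 7) = 0 %[mod 64],
      pp_bar (20 * n + 11) = 0 %[mod 5],
      pp_bar (20 * n + 15) = 0 %[mod 5] &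
      pp_bar (20 * n + 19) = 0 %[mod 5]].
Proof.
by split; apply: pp_bar_dvd; [exact: vanish64 pp_gf_phi | apply: vanish5 pp_gf_phi _..].
Qed.
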